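(* Let $\Bbbk$ be a field of characteristic zero and let $\alpha,\beta\in\Bbbk$ with $\beta\neq 0$ be such that $\Bbbk$ contains both roots of the polynomial $t^2-\alpha t-\beta$. Then the down-up algebra $A(\alpha,\beta,0)$ has a non-trivial, stably free right ideal.
   Context: For a field $\Bbbk$ and $\alpha,\beta,\gamma\in\Bbbk$, the down-up algebra $A(\alpha,\beta,\gamma)$ is the associative unital $\Bbbk$-algebra generated by $U$ and $D$ subject to the relations $DU^2=\alpha UDU+\beta U^2D+\gamma U$ and $D^2U=\alpha DUD+\beta UD^2+\gamma D$. A right $S$-module $P$ is stably free if $P\oplus S^m\cong S^n$ for some integers $m,n\geq 0$. A non-trivial stably free right ideal of a ring $S$ is a right ideal that is stably free but not free as a right $S$-module. *)

(* Defs.v *)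
From HB Require Import structures.
From mathcomp Require Import all_boot all_algebra.
From mathcomp Require Import boolp.
From mathcomp Require Import monalg.

Set Implicit Arguments.
Unset Strict Implicit.
Unset Printing Implicit Defensive.

Import GRing.Theory.
Local Open Scope ring_scope.
Local Open Scope quotient_scope.

Section Presentation.
Variables (k : fieldType) (A : algType k) (r : seq A).

(* The two-sided ideal generated by r: a triple ((a, x), b) in s stands for
   the product a * x * b. *)
Definition ideal_gen : {pred A} := fun y =>
  `[< exists2 s : seq (A * A * A), all (fun t => t.1.2 \in r) s
        & y = \sum_(t <- s) t.1.1 * t.1.2 * t.2 >].

Fact ideal_genP y : reflect
  (exists2 s : seq (A * A * A), all (fun t => t.1.2 \in r) s
     & y = \sum_(t <- s) t.1.1 * t.1.2 * t.2)
  (y \in ideal_gen).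
Proof. exact: asboolP. Qed.

Fact ideal_gen_mem y : y \in r -> y \in ideal_gen.
Proof.
move=> ry; apply/ideal_genP; exists [:: (1, y, 1)]; first by rewrite /= ry.
by rewrite big_seq1 mul1r mulr1.
Qed.

Fact ideal_genMl a y : y \in ideal_gen -> a * y \in ideal_gen.
Proof.
move=> /ideal_genP[s rs ->]; apply/ideal_genP.
exists [seq (a * t.1.1, t.1.2, t.2) | t <- s]; first by rewrite all_map.
by rewrite big_map mulr_sumr; apply: eq_bigr => t _; rewrite !mulrA.
Qed.

Fact ideal_genMr a y : y \in ideal_gen -> y * a \in ideal_gen.
Proof.
move=> /ideal_genP[s rs ->]; apply/ideal_genP.
exists [seq (t.1.1, t.1.2, t.2 * a) | t <- s]; first by rewrite all_map.
by rewrite big_map mulr_suml; apply: eq_bigr => t _; rewrite !mulrA.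
Qed.

Fact ideal_gen_ker (B : algType k) (f : {lrmorphism A -> B}) :
  {in r, forall x, f x = 0} -> {in ideal_gen, forall y, f y = 0}.
Proof.
move=> fr0 _ /ideal_genP[s /allP rs ->].
rewrite rmorph_sum big_seq big1 // => t /rs rt.
by rewrite !rmorphM /= (fr0 _ rt) mulr0 mul0r.
Qed.

Fact ideal_gen_proper (B : algType k) (f : {lrmorphism A -> B}) :
  {in r, forall x, f x = 0} -> 1 \notin ideal_gen.
Proof.
move=> /ideal_gen_ker fr0; apply/negP => /fr0/eqP.
by rewrite rmorph1 oner_eq0.
Qed.

Fact ideal_gen_zmod_closed : zmod_closed ideal_gen.
Proof.
split; first by apply/ideal_genP; exists [::]; rewrite ?big_nil.
move=> x y xI; rewrite -mulN1r => /(ideal_genMl (-1)).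
move: xI => /ideal_genP[s rs ->] /ideal_genP[s' rs' ->].
by apply/ideal_genP; exists (s ++ s'); rewrite ?all_cat ?rs ?big_cat.
Qed.
HB.instance Definition _ :=
  GRing.isZmodClosed.Build A ideal_gen ideal_gen_zmod_closed.

(* Rings are required to satisfy 1 != 0 to be instances of algType. *)
Definition quot_alg of 1 \notin ideal_gen := Quotient.quot ideal_gen.

Variable proper : 1 \notin ideal_gen.
Local Notation Q := (quot_alg proper).

HB.instance Definition _ := GRing.Zmodule.on Q.
HB.instance Definition _ := EqQuotient.on Q.

Definition quot_pi (x : A) : Q := \pi_Q x.

Fact quot_piP x y : reflect (quot_pi x = quot_pi y) (x - y \in ideal_gen).
Proof. by rewrite Quotient.idealrBE; apply: eqP. Qed.

Fact quot_pi_surj q : exists x, q = quot_pi x.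
Proof. by exists (repr q); rewrite /quot_pi reprK. Qed.

Fact quot_pi_repr x : repr (quot_pi x) - x \in ideal_gen.
Proof. by apply/quot_piP; rewrite /quot_pi reprK. Qed.

Fact quot_piB : zmod_morphism quot_pi.
Proof.
by move=> x y; rewrite /quot_pi !piE.
Qed.
HB.instance Definition _ := GRing.isZmodMorphism.Build A Q quot_pi quot_piB.

Definition quot_mul (p q : Q) : Q := quot_pi (repr p * repr q).
Definition quot_scale (a : k) (p : Q) : Q := quot_pi (a *: repr p).

Fact quot_mul_pi x y : quot_mul (quot_pi x) (quot_pi y) = quot_pi (x * y).
Proof.
apply/quot_piP; rewrite -(subrKA (x * repr (quot_pi y))) -mulrBl -mulrBr.
by rewrite rpredD //; [apply: ideal_genMr | apply: ideal_genMl]; apply: quot_pi_repr.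
Qed.

Fact quot_scale_pi a x : quot_scale a (quot_pi x) = quot_pi (a *: x).
Proof.
apply/quot_piP; rewrite -scalerBr -[_ - x]mul1r scalerAl.
by rewrite ideal_genMl ?quot_pi_repr.
Qed.

Let lift (P : Q -> Prop) : (forall x, P (quot_pi x)) -> forall q, P q.
Proof. by move=> piP q; have [x ->] := quot_pi_surj q. Qed.

Fact quot_mulA : associative quot_mul.
Proof.
by elim/lift=> x; elim/lift=> y; elim/lift=> z; rewrite !quot_mul_pi mulrA.
Qed.

Fact quot_mul1 : left_id (quot_pi 1) quot_mul.
Proof. by elim/lift=> x; rewrite quot_mul_pi mul1r. Qed.

Fact quot_mulr1 : right_id (quot_pi 1) quot_mul.
Proof. by elim/lift=> x; rewrite quot_mul_pi mulr1. Qed.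

Fact quot_mulDl : left_distributive quot_mul +%R.
Proof.
elim/lift=> x; elim/lift=> y; elim/lift=> z.
by rewrite -raddfD !quot_mul_pi mulrDl raddfD.
Qed.

Fact quot_mulDr : right_distributive quot_mul +%R.
Proof.
elim/lift=> x; elim/lift=> y; elim/lift=> z.
by rewrite -raddfD !quot_mul_pi mulrDr raddfD.
Qed.

Fact quot_1neq0 : quot_pi 1 != 0.
Proof.
rewrite -(raddf0 quot_pi); apply/eqP => /quot_piP.
by rewrite subr0; apply/negP.
Qed.

HB.instance Definition _ := GRing.Zmodule_isNzRing.Build Q
  quot_mulA quot_mul1 quot_mulr1 quot_mulDl quot_mulDr quot_1neq0.

Fact quot_scaleA a b p : quot_scale a (quot_scale b p) = quot_scale (a * b) p.
Proof. by elim/lift: p => x; rewrite !quot_scale_pi scalerA. Qed.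

Fact quot_scale1 : left_id 1 quot_scale.
Proof. by elim/lift=> x; rewrite quot_scale_pi scale1r. Qed.

Fact quot_scaleDr : right_distributive quot_scale +%R.
Proof.
move=> a; elim/lift=> x; elim/lift=> y.
by rewrite -raddfD !quot_scale_pi scalerDr raddfD.
Qed.

Fact quot_scaleDl p : {morph quot_scale^~ p : a b / a + b}.
Proof. by move=> a b; elim/lift: p => x; rewrite !quot_scale_pi scalerDl raddfD. Qed.

HB.instance Definition _ := GRing.Zmodule_isLmodule.Build k Q
  quot_scaleA quot_scale1 quot_scaleDr quot_scaleDl.

Fact quot_scaleAl a (p q : Q) : a *: (p * q) = a *: p * q.
Proof.
elim/lift: p => x; elim/lift: q => y; rewrite /GRing.scale /GRing.mul /=.
by rewrite !(quot_scale_pi, quot_mul_pi) scalerAl.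
Qed.
HB.instance Definition _ := GRing.Lmodule_isLalgebra.Build k Q quot_scaleAl.

Fact quot_scaleAr a (p q : Q) : a *: (p * q) = p * (a *: q).
Proof.
elim/lift: p => x; elim/lift: q => y; rewrite /GRing.scale /GRing.mul /=.
by rewrite !(quot_scale_pi, quot_mul_pi) scalerAr.
Qed.
HB.instance Definition _ := GRing.Lalgebra_isAlgebra.Build k Q quot_scaleAr.

Fact quot_pi_monoid_morphism : monoid_morphism quot_pi.
Proof. by split=> // x y; rewrite -quot_mul_pi. Qed.
HB.instance Definition _ :=
  GRing.isMonoidMorphism.Build A Q quot_pi quot_pi_monoid_morphism.

Fact quot_piZ : scalable quot_pi.
Proof. by move=> a x; rewrite -quot_scale_pi. Qed.
HB.instance Definition _ := GRing.isScalable.Build k A Q *:%R quot_pi quot_piZ.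

Fact quot_pi_eq0 x : x \in r -> quot_pi x = 0.
Proof.
move=> rx; rewrite -(raddf0 quot_pi).
by apply/quot_piP; rewrite subr0 ideal_gen_mem.
Qed.

Fact quot_alg_univ (B : algType k) (f : {lrmorphism A -> B}) :
  {in r, forall x, f x = 0} ->
  exists g : {lrmorphism Q -> B}, forall x, g (quot_pi x) = f x.
Proof.
move=> fr0; pose g (q : Q) := f (repr q).
have gE x : g (quot_pi x) = f x.
  apply/eqP; rewrite -subr_eq0 -rmorphB; apply/eqP.
  exact: (ideal_gen_ker fr0) (quot_pi_repr x).
have gB : zmod_morphism g.
  by elim/lift=> x; elim/lift=> y; rewrite -raddfB !gE raddfB.
have gM : monoid_morphism g.
  split; first by rewrite -(rmorph1 quot_pi) gE rmorph1.
  by elim/lift=> x; elim/lift=> y; rewrite -rmorphM !gE rmorphM.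
have gZ : scalable g.
  by move=> a; elim/lift=> x; rewrite -linearZ !gE linearZ.
pose m1 := GRing.isZmodMorphism.Build _ _ g gB.
pose m2 := GRing.isMonoidMorphism.Build _ _ g gM.
pose m3 := GRing.isScalable.Build _ _ _ _ g gZ.
pose G : {lrmorphism Q -> B} := HB.pack g m1 m2 m3.
by exists G; apply: gE.
Qed.

End Presentation.

(* The free algebra on U := << fmu true >> and D := << fmu false >>. *)
Section FreeAlgebra.
Variable k : fieldType.

Definition free_alg2 := {malg k[{fmonom bool}]}.
HB.instance Definition _ := GRing.Lalgebra.on free_alg2.

Definition freeU : free_alg2 := << fmu true >>.
Definition freeD : free_alg2 := << fmu false >>.

Fact free_alg2_scaleAr a (x y : free_alg2) : a *: (x * y) = x * (a *: y).
Proof.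
have cC (z : free_alg2) : a%:MP * z = z * a%:MP.
  rewrite !malgM_def fgmulUg fgmulgU; apply: eq_bigr => w _.
  by rewrite mulrC mul1m mulm1.
by rewrite -!mul_malgC mulrA cC -mulrA.
Qed.
HB.instance Definition _ :=
  GRing.Lalgebra_isAlgebra.Build k free_alg2 free_alg2_scaleAr.

Fact free_alg2_ind (P : free_alg2 -> Prop) :
  P 0 -> P 1 -> (forall x y, P x -> P y -> P (x + y)) ->
  (forall a x, P x -> P (a *: x)) ->
  (forall x, P x -> P (freeU * x)) -> (forall x, P x -> P (freeD * x)) ->
  forall x, P x.
Proof.
move=> P0 P1 PD PZ PU PD'.
have Pword (w : seq bool) : P << FMonom w >>.
  elim: w => [|b w IHw]; first by rewrite -fmoneE.
  have -> : << FMonom (b :: w) >> = (<< fmu b >> : free_alg2) * << FMonom w >>.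
    rewrite malgM_def fgmulUU mulr1; congr mkmalgU.
    by apply/eqP; rewrite -val_eqE /= fmM fmU.
  by case: b; [apply: PU | apply: PD'].
have mkZ (c : k) w : << c *g w >> = c *: (<< w >> : {malg k[{fmonom bool}]}).
  by apply/malgP => v; rewrite mcoeffZ !mcoeffU mulrnAr mulr1.
move=> x; rewrite [x]monalgE; apply: (big_ind P) => // -[w] _.
by rewrite mkZ; apply: PZ.
Qed.

Section Eval.
Variables (B : algType k) (u d : B).

Let ev_word (w : {fmonom bool}) : B := \prod_(b <- w) (if b then u else d).

Let ev_word_mmorphism : mmorphism ev_word.
Proof.
split=> [x y|]; rewrite /ev_word ?fmM ?fm1 ?big_nil //.
by rewrite big_cat.
Qed.
HB.instance Definition _ :=
  monalg.isMultiplicative.Build {fmonom bool} B ev_word ev_word_mmorphism.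

Let evm : free_alg2 -> B := mmap (in_alg B) ev_word.

Fact free_alg2_univ : exists f : {lrmorphism free_alg2 -> B},
  f freeU = u /\ f freeD = d.
Proof.
have evB : zmod_morphism evm by apply: mmap_is_additive.
have evM : monoid_morphism evm.
  suff [] : multiplicative evm by [].
  apply: commr_mmap_is_multiplicative => g m m'.
  by rewrite /GRing.comm /= mulr_algl mulr_algr.
have evZ : scalable evm by move=> a x; rewrite /evm mmapZ /= mulr_algl.
pose m1 := GRing.isZmodMorphism.Build _ _ evm evB.
pose m2 := GRing.isMonoidMorphism.Build _ _ evm evM.
pose m3 := GRing.isScalable.Build _ _ _ _ evm evZ.
pose f : {lrmorphism free_alg2 -> B} := HB.pack evm m1 m2 m3.
exists f; split; rewrite /f /= /evm mmapU /= scale1r mul1r /ev_word fmU;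
  by rewrite big_seq1.
Qed.

End Eval.
End FreeAlgebra.

Section DownUp.
Variables (k : fieldType) (alpha beta gamma : k).

Definition down_up_rel (A : algType k) (U D : A) : Prop :=
  D * U ^+ 2 = alpha *: (U * D * U) + beta *: (U ^+ 2 * D) + gamma *: U /\
  D ^+ 2 * U = alpha *: (D * U * D) + beta *: (U * D ^+ 2) + gamma *: D.

Definition down_up_relators (A : algType k) (U D : A) : seq A :=
  [:: D * U ^+ 2
        - (alpha *: (U * D * U) + beta *: (U ^+ 2 * D) + gamma *: U);
      D ^+ 2 * U
        - (alpha *: (D * U * D) + beta *: (U * D ^+ 2) + gamma *: D)].

Fact down_up_relatorsP (A B : algType k) (f : {lrmorphism A -> B}) (U D : A) :
  {in down_up_relators U D, forall x, f x = 0} <-> down_up_rel (f U) (f D).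
Proof.
pose r (C : algType k) (u d : C) :=
  d * u ^+ 2 - (alpha *: (u * d * u) + beta *: (u ^+ 2 * d) + gamma *: u).
pose r' (C : algType k) (u d : C) :=
  d ^+ 2 * u - (alpha *: (d * u * d) + beta *: (u * d ^+ 2) + gamma *: d).
have fZ a x : f (a *: x) = a *: f x by apply: linearZ.
have [fB fD] : {morph f : x y / x - y} /\ {morph f : x y / x + y}.
  by split=> x y; [apply: rmorphB | apply: rmorphD].
have fM : {morph f : x y / x * y} by apply: rmorphM.
have fr : f (r A U D) = r B (f U) (f D) by rewrite /r !(fB, fD, fZ, fM).
have fr' : f (r' A U D) = r' B (f U) (f D) by rewrite /r' !(fB, fD, fZ, fM).
split=> [f0|[/eqP + /eqP +] x].
  split; apply/eqP; rewrite -subr_eq0; apply/eqP.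
    by rewrite -[LHS]fr f0 ?mem_head.
  by rewrite -[LHS]fr' f0 // !inE eqxx orbT.
rewrite -subr_eq0 -[_ - _]fr => /eqP f0.
by rewrite -subr_eq0 -[_ - _]fr' => /eqP f0'; rewrite !inE => /pred2P[] ->.
Qed.

Fact down_up_proper :
  1 \notin ideal_gen (down_up_relators (freeU k) (freeD k)).
Proof.
have [f [fU fD]] := free_alg2_univ (0 : k^o) 0.
apply: (@ideal_gen_proper _ _ _ _ f).
apply/down_up_relatorsP; rewrite fU fD; split;
  by rewrite !(mul0r, mulr0, scaler0, addr0).
Qed.

Definition down_up := quot_alg down_up_proper.
HB.instance Definition _ := GRing.Algebra.on down_up.

Definition duU : down_up := quot_pi down_up_proper (freeU k).
Definition duD : down_up := quot_pi down_up_proper (freeD k).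

Lemma down_up_relP : down_up_rel duU duD.
Proof.
have /down_up_relatorsP : {in down_up_relators (freeU k) (freeD k),
  forall x, quot_pi down_up_proper x = 0} by apply: quot_pi_eq0.
exact.
Qed.

Lemma down_up_univ (B : algType k) (u d : B) : down_up_rel u d ->
  exists f : {lrmorphism down_up -> B}, f duU = u /\ f duD = d.
Proof.
have [f [<- <-]] := free_alg2_univ u d.
move=> /down_up_relatorsP/(quot_alg_univ down_up_proper)[g gE].
by exists g; rewrite !gE.
Qed.

Lemma down_up_univ_uniq (B : algType k) (f g : {lrmorphism down_up -> B}) :
  f duU = g duU -> f duD = g duD -> f =1 g.
Proof.
move=> fgU fgD q; have [x ->] := @quot_pi_surj _ _ _ down_up_proper q.
pose p := quot_pi down_up_proper; rewrite -/p.
have [p0 p1] : p 0 = 0 /\ p 1 = 1 by rewrite /p raddf0 rmorph1.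
have pD : {morph p : x y / x + y} by apply: raddfD.
have pM : {morph p : x y / x * y} by apply: rmorphM.
have pZ a y : p (a *: y) = a *: p y by apply: linearZ.
have [pU pU'] : p (freeU k) = duU /\ p (freeD k) = duD by [].
have hD (h : {lrmorphism down_up -> B}) : {morph h : x y / x + y}.
  by apply: rmorphD.
have hM (h : {lrmorphism down_up -> B}) : {morph h : x y / x * y}.
  by apply: rmorphM.
have hZ (h : {lrmorphism down_up -> B}) a y : h (a *: y) = a *: h y.
  by apply: linearZ.
move: x; apply: free_alg2_ind => [||x y IHx IHy|a x IHx|x IHx|x IHx].
- by rewrite p0 !raddf0.
- by rewrite p1 !rmorph1.
- by rewrite pD !hD IHx IHy.
- by rewrite pZ !hZ IHx.
- by rewrite pM !hM IHx pU fgU.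
- by rewrite pM !hM IHx pU' fgD.
Qed.

End DownUp.

Definition submodule (R : pzRingType) (M : lmodType R) (N : submodClosed M) :=
  {x : M | x \in N}.
HB.instance Definition _ R M N := [isSub of @submodule R M N for @sval _ _].
HB.instance Definition _ R M N := [Choice of @submodule R M N by <:].
HB.instance Definition _ R M N :=
  [SubChoice_isSubLmodule of @submodule R M N by <:].

(* A right S-module is a left module over the converse ring S^c. In particular
   (S^c)^o is S as a right module over itself (a *: x is x * a in S), and a
   right ideal is a submodule of it. *)
Definition right_ideal (S : pzRingType) := submodClosed (S^c)^o.

Definition lmod_isomorphic (R : pzRingType) (M N : lmodType R) : Prop :=
  exists f : {linear M -> N}, bijective f.

Definition lmod_basis (R : pzRingType) (M : lmodType R) (B : M -> Prop) : Prop :=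
  (forall s : seq M, uniq s -> (forall b, b \in s -> B b) ->
     forall c : M -> R, \sum_(b <- s) c b *: b = 0 ->
     forall b, b \in s -> c b = 0) /\
  (forall x : M, exists (s : seq M) (c : M -> R),
     (forall b, b \in s -> B b) /\ x = \sum_(b <- s) c b *: b).

(* Free modules of arbitrary rank, finite or infinite. *)
Definition lmod_free (R : pzRingType) (M : lmodType R) : Prop :=
  exists B : M -> Prop, lmod_basis B.

Definition stably_free (R : pzRingType) (M : lmodType R) : Prop :=
  exists m n : nat, lmod_isomorphic (M * 'rV[R]_m)%type 'rV[R]_n.

Definition nontrivial_stably_free_right_ideal (S : pzRingType)
    (I : right_ideal S) : Prop :=
  stably_free (submodule I) /\ ~ lmod_free (submodule I).

(* Main.v *)
Require Import Defs.
From HB Require Import structures.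
From mathcomp Require Import all_boot all_algebra.
From mathcomp Require Import boolp zify ring.

Set Implicit Arguments.
Unset Strict Implicit.
Unset Printing Implicit Defensive.

Import GRing.Theory.
Local Open Scope ring_scope.

(** Let A be the down-up algebra, r1 and r2 the roots (both nonzero), and
    Om = D U - r1 U D.  The defining relations say exactly that Om normalizes
    the generators: Om U = r2 U Om and D Om = r2 Om D.

    A row (p, q) over a ring S with p x + q y = 1 has a kernel K in S^2 with
    K + S = S^2.  If q is left regular, projecting K to the first coordinate
    is injective, and its image is the right ideal {v | p v in q S}, so this
    ideal is stably free (kernel_ideal_split).  Were it free, comparing ranks
    over the field k, through the augmentation A -> k, would make it cyclic
    (lmod_free_cyclic).  A generator survives every ring morphism
    (kernel_ideal_generator_map), so it is enough to contradict cyclicity in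
    the image of the row in a simpler algebra.

    Here q = D + 1, which is regular because the relations are homogeneous
    and q has constant term 1 (down_up_regular).  The simpler algebra is an
    Ore extension B of k[X], with D as the variable and U sent to X: the
    quantum plane D U = r1 U D when r1 <> 1 (Om maps to 0), and the Weyl algebra
    D U - U D = 1 when r1 = r2 = 1 (Om maps to 1).  The entry p is chosen so
    that the row is unimodular in A and p maps to 1 + X:
    - p = 1 + U + e Om when r1 <> r2 and r1 <> 1, with e such that right
      multiplication by D, modulo (D + 1) A, scales U + e Om;
    - p = 1 + U when r1 = r2 <> 1;
    - p = 1 + Om U when r1 = r2 = 1.

    In B = k[X][D] the row (1 + X, D + 1) has no cyclic kernel ideal
    (ore_kernel_not_cyclic).  This is Stafford's degree argument.  The ideal
    contains no nonzero constant, but an element of degree 1, and every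
    element of degree 1 in it has
    leading coefficient divisible by r = 1 + X.  So a generator has degree 1,
    and every element of degree 2 has leading coefficient divisible by the
    nonunit tau(r).  But the ideal also contains a monic element of degree 2. *)

(** * Kernel ideals of unimodular rows *)

Section FreeRank.
Variables (R : nzRingType) (M : lmodType R).

Lemma lmod_isomorphic_inv (N : lmodType R) (g : N -> M) :
    linear g -> (forall y, g y = 0 -> y = 0) -> (forall x, exists y, g y = x) ->
  lmod_isomorphic M N.
Proof.
move=> g_lin g_ker /choice[f gK].
have g_inj : injective g.
  move=> y z gyz; apply/eqP; rewrite eq_sym -subr_eq0 addrC -scaleN1r.
  by apply/eqP/g_ker; rewrite g_lin gyz scaleN1r addNr.
have fK : cancel g f by move=> y; apply: g_inj; rewrite gK.
have f_lin : linear f.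
  by move=> a x y; apply: g_inj; rewrite g_lin !gK.
pose m := GRing.isLinear.Build _ _ _ _ f f_lin.
pose F : {linear M -> N} := HB.pack f m.
by exists F; exists g.
Qed.

(** Finitely many elements, together with a prescribed part of the basis, can be
    expanded over a single duplicate-free list of basis elements, which is what
    makes coefficients comparable. *)
Lemma lmod_basis_common_support (B : M -> Prop) (s : seq M) n (x : 'I_n -> M) :
    lmod_basis B -> (forall b, b \in s -> B b) ->
  exists (t : seq M) (c : 'I_n -> M -> R),
    [/\ uniq t, {subset s <= t}, forall b, b \in t -> B b &
        forall j, x j = \sum_(b <- t) c j b *: b].
Proof.
move=> [_ span] sB.
have /choice[u /choice[c uc]] : forall j, exists u, exists c : M -> R,
    (forall b, b \in u -> B b) /\ x j = \sum_(b <- u) c b *: b.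
  by move=> j; apply: span.
pose t := undup (s ++ flatten [seq u j | j <- enum 'I_n]).
have u_t j b : b \in u j -> b \in t.
  move=> bu; rewrite mem_undup mem_cat; apply/orP; right.
  by apply/flatten_mapP; exists j; rewrite ?mem_enum.
exists t, (fun j b => \sum_(b' <- u j | b' == b) c j b'); split.
- exact: undup_uniq.
- by move=> b bs; rewrite mem_undup mem_cat bs.
- move=> b; rewrite mem_undup mem_cat => /orP[/sB//|/flatten_mapP[j _]].
  by apply: (uc j).1.
move=> j; rewrite [LHS](uc j).2.
under [RHS]eq_bigr do rewrite scaler_suml.
rewrite (exchange_big_dep predT) //= big_seq [RHS]big_seq.
apply: eq_bigr => b /u_t bt.
under eq_bigl do rewrite eq_sym.
by rewrite -big_filter filter_pred1_uniq ?undup_uniq // big_seq1.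
Qed.

(** Invariance of the basis number, in the form needed for a module whose freeness
    is only hypothetical: coordinates along s and along R^m give matrices whose
    product is the identity of size (size s + m), factoring through R^n.  A ring
    morphism to a commutative ring turns this into a statement on commutative
    matrices. *)
Lemma lmod_basis_rank (F : comNzRingType) (eps : {rmorphism R -> F})
    (B : M -> Prop) (s : seq M) m n :
    lmod_isomorphic (M * 'rV[R]_m)%type 'rV[R]_n -> lmod_basis B ->
  uniq s -> (forall b, b \in s -> B b) -> (size s + m <= n)%N.
Proof.
move=> [f [g fK gK]] basisB s_uniq sB.
pose x j := (g (delta_mx 0 j)).1; pose w j := (g (delta_mx 0 j)).2.
have [t [c [t_uniq s_t tB xE]]] := lmod_basis_common_support x basisB sB.
have gE z : z = \sum_j (f z) 0 j *: (x j, w j).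
  apply: (can_inj fK); rewrite linear_sum [LHS]row_sum_delta.
  by apply: eq_bigr => j _; rewrite linearZ /= /x /w -surjective_pairing gK.
have gE1 z : z.1 = \sum_(b <- t) (\sum_j (f z) 0 j * c j b) *: b.
  rewrite [in LHS](gE z) (raddf_sum fst) /=.
  under eq_bigr do rewrite xE scaler_sumr.
  rewrite exchange_big; apply: eq_bigr => b _ /=.
  by rewrite scaler_suml; apply: eq_bigr => j _; rewrite scalerA.
have gE2 (z : M * 'rV[R]_m) i : z.2 0 i = \sum_j (f z) 0 j * w j 0 i.
  rewrite [in LHS](gE z) (raddf_sum snd) /= summxE.
  by apply: eq_bigr => j _; rewrite mxE.
have coord z (d : M -> R) : z.1 = \sum_(b <- t) d b *: b ->
    forall b, b \in t -> \sum_j (f z) 0 j * c j b = d b.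
  move=> zd b bt; apply/eqP; rewrite -subr_eq0; apply/eqP; move: b bt.
  apply: basisB.1 => //; under eq_bigr do rewrite scalerBl.
  by rewrite sumrB -gE1 -zd subrr.
have sumM (u v : 'I_n -> R) :
    \sum_j eps (u j) * eps (v j) = eps (\sum_j u j * v j).
  by rewrite rmorph_sum; apply: eq_bigr => j _; rewrite rmorphM.
pose S := in_tuple s; pose l := size s.
pose P1 := \matrix_(i < l, j < n) eps (f (tnth S i, 0 : 'rV[R]_m) 0 j).
pose P2 := \matrix_(i < m, j < n) eps (f (0 : M, delta_mx 0 i) 0 j).
pose Q1 := \matrix_(j < n, i < l) eps (c j (tnth S i)).
pose Q2 := \matrix_(j < n, i < m) eps (w j 0 i).
apply: (@mulmx1_min F _ _ (col_mx P1 P2) (row_mx Q1 Q2)).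
rewrite mul_col_row scalar_mx_block; congr block_mx; apply/matrixP=> i i'.
- rewrite !mxE; under eq_bigr do rewrite !mxE; rewrite sumM.
  rewrite (coord _ (fun b => (tnth S i == b)%:R)) ?rmorph_nat.
  + by rewrite (inj_eq (tuple_uniqP _ _)).
  + under eq_bigr do rewrite scaler_nat mulrb eq_sym.
    by rewrite -big_mkcond -big_filter filter_pred1_uniq ?s_t ?mem_tnth ?big_seq1.
  + by rewrite s_t ?mem_tnth.
- rewrite !mxE; under eq_bigr do rewrite !mxE.
  by rewrite sumM -gE2 mxE rmorph0.
- rewrite !mxE; under eq_bigr do rewrite !mxE; rewrite sumM.
  rewrite (coord _ (fun=> 0)) ?rmorph0 ?s_t ?mem_tnth //=.
  by rewrite big1 // => b _; rewrite scale0r.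
- rewrite !mxE; under eq_bigr do rewrite !mxE.
  by rewrite sumM -gE2 mxE rmorph_nat eqxx [i' == i]eq_sym.
Qed.

(** The rank bound leaves room for at most one basis element. *)
Lemma lmod_free_cyclic (F : comNzRingType) (eps : {rmorphism R -> F}) m :
    lmod_isomorphic (M * 'rV[R]_m)%type 'rV[R]_m.+1 -> lmod_free M ->
  exists b0 : M, forall x, exists a, x = a *: b0.
Proof.
move=> iso [B basisB].
have one b b' : B b -> B b' -> b = b'.
  move=> Bb Bb'; apply/eqP/negP => /negP bb'.
  have := lmod_basis_rank eps (s := [:: b; b']) iso basisB.
  rewrite /= inE bb' /= => /(_ isT); suff sB : forall c, c \in [:: b; b'] -> B c.
    by move=> /(_ sB); lia.
  by move=> c; rewrite !inE => /orP[]/eqP->.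
have [[b0 Bb0]|nB] := pselect (exists b, B b).
  exists b0 => x; have [s [c [sB ->]]] := basisB.2 x.
  exists (\sum_(b <- s) c b); rewrite scaler_suml big_seq [RHS]big_seq.
  by apply: eq_bigr => b /sB Bb; rewrite (one _ _ Bb Bb0).
exists 0 => x; exists 0; have [s [c [sB ->]]] := basisB.2 x.
rewrite scaler0 big_seq big1 // => b /sB Bb; by case: nB; exists b.
Qed.
End FreeRank.

Section KernelIdeal.
Variables (S : nzRingType) (p q : S).

Definition kernel_ideal_pred : {pred (S^c)^o} :=
  fun v => `[< exists u : S, p * v = q * u >].

Fact kernel_ideal_closed : submod_closed kernel_ideal_pred.
Proof.
split=> [|a u v /asboolP[u' pu] /asboolP[v' pv]]; apply/asboolP.
  by exists 0; rewrite !mulr0.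
exists (u' * a + v').
transitivity (p * ((u : S) * (a : S) + (v : S))); first by [].
by rewrite mulrDr mulrA pu pv -mulrA -mulrDr.
Qed.
HB.instance Definition _ :=
  GRing.isSubmodClosed.Build _ _ kernel_ideal_pred kernel_ideal_closed.

(** The first coordinates of the vectors (v, - u) killed by the row (p, q). *)
Definition kernel_ideal : right_ideal S := kernel_ideal_pred.

Lemma kernel_idealP (v : S) :
  reflect (exists u, p * v = q * u) (v \in (kernel_ideal : {pred _})).
Proof. exact: asboolP. Qed.

Variables (x y : S).
Hypotheses (pq1 : p * x + q * y = 1) (q_reg : forall u, q * u = 0 -> u = 0).

Let row (w : 'rV[S^c]_2) : S := p * (w 0 0) + q * (w 0 1).

(* The projection of S^2 onto the kernel of the row along its section (x, y),
   followed by the first coordinate. *)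
Let proj (w : 'rV[S^c]_2) : S := (w 0 0 : S) - x * row w.

Let proj_in w : proj w \in (kernel_ideal : {pred _}).
Proof.
apply/kernel_idealP; exists (y * row w - w 0 1); rewrite /proj !mulrBr !mulrA.
rewrite -[q * y](addKr (p * x)) pq1 mulrDl mul1r mulNr.
have rowE : row w - q * w 0 1 = p * w 0 0 by rewrite /row addrK.
by rewrite -addrA rowE addrC.
Qed.

(** A unimodular row splits S^2 as its kernel plus S.  Regularity of q identifies
    the kernel with the ideal. *)
Lemma kernel_ideal_split :
  lmod_isomorphic (submodule kernel_ideal * 'rV[S^c]_1)%type 'rV[S^c]_2.
Proof.
pose g (w : 'rV[S^c]_2) : (submodule kernel_ideal * 'rV[S^c]_1)%type :=
  (exist _ (proj w) (proj_in w), const_mx (row w)).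
have rowL a u v : row (a *: u + v) = row u * (a : S) + row v.
  transitivity (p * ((u 0 0 : S) * (a : S) + v 0 0) +
                q * ((u 0 1 : S) * (a : S) + v 0 1)).
    by rewrite /row !mxE.
  by rewrite /row !mulrDr !mulrA mulrDl addrACA.
have projL a u v : proj (a *: u + v) = proj u * (a : S) + proj v.
  transitivity ((u 0 0 : S) * (a : S) + v 0 0 - x * row (a *: u + v)).
    by rewrite /proj !mxE.
  by rewrite rowL mulrDr mulrA opprD addrACA -mulrBl.
have g_lin : linear g.
  move=> a u v; congr pair; last by apply/rowP=> i; rewrite !mxE rowL.
  by apply: val_inj; rewrite /= projL.
have g_ker w : g w = (0, 0) -> w = 0.
  move=> gw0.
  have row0 : row w = 0.
    by have := congr1 snd gw0; move=> /rowP/(_ 0); rewrite !mxE.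
  have w0 : w 0 0 = 0.
    have := congr1 (fun z => \val z.1) gw0.
    by rewrite /= /proj row0 mulr0 subr0.
  have w1 : w 0 1 = 0.
    by apply: q_reg; move: row0; rewrite /row w0 mulr0 add0r.
  apply/rowP=> -[[|[|//]] i2]; rewrite mxE -[RHS]/(0 : S).
    by rewrite -w0; congr (w _ _); apply: val_inj.
  by rewrite -w1; congr (w _ _); apply: val_inj.
apply: (lmod_isomorphic_inv g_lin g_ker).
move=> [[v vI] s]; have /kernel_idealP[u pv] := vI.
pose t : S := s 0 0.
pose w : 'rV[S^c]_2 :=
  \row_j (if j == 0 then (v : S) + x * t else y * t - u : S).
exists w.
have wt : row w = t.
  rewrite /row !mxE /= mulrDr mulrBr !mulrA pv.
  by rewrite [q * u + _]addrC -addrA [q * u + _]addrC subrK -mulrDl pq1 mul1r.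
congr pair; last by apply/rowP=> i; rewrite !mxE ord1 wt.
by apply: val_inj; rewrite /= /proj wt !mxE /= addrK.
Qed.
End KernelIdeal.

(** The vectors (1 - x p, - y p) and (- x q, 1 - y q), which span the kernel
    of a unimodular row, are given by formulas, hence are preserved by phi.
    Over A both are multiples of the generator. *)
Lemma kernel_ideal_generator_map (A B : nzRingType)
    (phi : {rmorphism A -> B}) (p q x y c : A) :
    p * x + q * y = 1 ->
    (forall v u, p * v = q * u -> exists g, v = c * g) ->
  forall v u, phi p * v = phi q * u -> exists g, v = phi c * g.
Proof.
move=> pq1 gen v u pv.
have [h1 e1] : exists g, 1 - x * p = c * g.
  apply: (gen _ (y * p)); apply/eqP.
  by rewrite mulrBr mulr1 subr_eq !mulrA -mulrDl addrC pq1 mul1r.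
have [h2 e2] : exists g, x * q = c * g.
  apply: (gen _ (1 - y * q)); apply/eqP.
  by rewrite mulrBr mulr1 eq_sym subr_eq !mulrA -mulrDl pq1 mul1r.
exists (phi h1 * v + phi h2 * u); rewrite mulrDr !mulrA -!rmorphM -e1 -e2.
rewrite rmorphB rmorph1 mulrBl mul1r !rmorphM -!mulrA -pv.
by rewrite subrK.
Qed.

Lemma kernel_ideal_nontrivial (A : nzRingType) (p q x y : A)
    (F : comNzRingType) (eps : {rmorphism A -> F}) :
    p * x + q * y = 1 -> (forall u, q * u = 0 -> u = 0) ->
    (forall c c' : A, p * c = q * c' ->
     ~ (forall v u, p * v = q * u -> exists g, v = c * g)) ->
  nontrivial_stably_free_right_ideal (kernel_ideal p q).
Proof.
move=> pq1 q_reg not_cyclic; have split := kernel_ideal_split pq1 q_reg.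
split; first by exists 1%N, 2%N.
have epsM : monoid_morphism (eps : A^c -> F).
  split; first exact: rmorph1.
  by move=> a b; rewrite [LHS]rmorphM; exact: mulrC.
have epsB : zmod_morphism (eps : A^c -> F) by move=> a b; exact: (rmorphB eps).
pose epsc : {rmorphism A^c -> F} := HB.pack (eps : A^c -> F)
  (GRing.isZmodMorphism.Build _ _ (eps : A^c -> F) epsB)
  (GRing.isMonoidMorphism.Build _ _ (eps : A^c -> F) epsM).
move=> /(lmod_free_cyclic epsc split)[[c cI] gen].
have /kernel_idealP[c' pc] := cI.
apply: (not_cyclic c c' pc) => v u pv.
have vI : v \in (kernel_ideal p q : {pred _}) by apply/kernel_idealP; exists u.
have [g /(congr1 val) /= vE] := gen (exist _ v vI).
by exists g.
Qed.

(** * Ore extensions *)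

Section OreExtension.
Variables (k : fieldType) (R : algType k).

(** The rule a D = D tau(a) - der(a).  Coefficients are kept on the right of
    the powers of D, so tau is the inverse of the usual twist. *)
Record ore_data := OreData {
  ore_tau : {lrmorphism R -> R};
  ore_der : {linear R -> R};
  ore_leibniz : forall a b,
    ore_der (a * b) = ore_der a * ore_tau b + a * ore_der b }.

Variable s : ore_data.
Local Notation tau := (ore_tau s).
Local Notation der := (ore_der s).

Fact ore_der1 : der 1 = 0.
Proof.
apply: (addrI (der 1)); rewrite addr0 -[RHS]mul1r.
by have := ore_leibniz s 1 1; rewrite rmorph1 !mulr1 !mul1r => <-.
Qed.

(** Right multiplication by D.  The polynomial sum_i 'X^i * a_i encodes
    sum_i D^i a_i; the additive group is the commutative one, and only right
    multiplication by D is twisted. *)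
Definition ore_rmulX (p : {poly R}) : {poly R} :=
  'X * map_poly tau p - map_poly der p.

Fact ore_rmulX_zmod : zmod_morphism ore_rmulX.
Proof.
move=> p q; rewrite /ore_rmulX.
rewrite (raddfB (map_poly tau)) (raddfB (map_poly der)) /= mulrBr !opprB.
by rewrite addrACA [RHS]addrACA [- _ - _]addrC.
Qed.
HB.instance Definition _ :=
  GRing.isZmodMorphism.Build {poly R} {poly R} ore_rmulX ore_rmulX_zmod.

Lemma ore_rmulX_C a : ore_rmulX a%:P = 'X * (tau a)%:P - (der a)%:P.
Proof. by rewrite /ore_rmulX map_polyC /= !map_polyC. Qed.

Lemma ore_rmulX_mulX p : ore_rmulX ('X * p) = 'X * ore_rmulX p.
Proof.
apply/polyP=> i; rewrite /ore_rmulX !(coefB, coefXM, coef_map) /=.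
by case: i => [|[|i]]; rewrite /= ?raddf0 ?subrr ?coef_map ?addr0.
Qed.

Lemma ore_rmulX_X : ore_rmulX 'X = 'X * 'X.
Proof.
rewrite -[X in ore_rmulX X]mulr1 ore_rmulX_mulX -polyC1 ore_rmulX_C.
by rewrite rmorph1 ore_der1 subr0 mulr1.
Qed.

Lemma ore_rmulX_mulC p a :
  ore_rmulX (p * a%:P) = ore_rmulX p * (tau a)%:P - p * (der a)%:P.
Proof.
apply/polyP=> i; rewrite /ore_rmulX !(coefB, coefMC, coefXM, coef_map) /=.
rewrite ore_leibniz; case: i => [|i] /=.
  by rewrite mulrBl mul0r opprD addrA.
by rewrite rmorphM mulrBl opprD addrA.
Qed.

Lemma ore_rmulXZ c p : ore_rmulX ((c%:A : R) *: p) = (c%:A : R) *: ore_rmulX p.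
Proof.
apply/polyP=> i; rewrite /ore_rmulX !(coefB, coefZ, coefXM, coef_map) /=.
by rewrite !mulr_algl scalerBr !linearZ; case: i => [|i]; rewrite /= ?scaler0.
Qed.

Arguments ore_rmulX : simpl never.

(** p (sum_j D^j b_j) = sum_j (p D^j) b_j. *)
Definition ore_mul (p q : {poly R}) : {poly R} :=
  \sum_(j < size q) iter j ore_rmulX p * (q`_j)%:P.

Lemma ore_mul_widen n p (q : {poly R}) : (size q <= n)%N ->
  ore_mul p q = \sum_(j < n) iter j ore_rmulX p * (q`_j)%:P.
Proof.
move=> le_q_n; rewrite /ore_mul.
rewrite (big_ord_widen n (fun j => iter j ore_rmulX p * (q`_j)%:P)) //.
rewrite big_mkcond; apply: eq_bigr => j _; case: ltnP => // le_q_j.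
by rewrite nth_default // mulr0.
Qed.

Lemma ore_mulDr : right_distributive ore_mul +%R.
Proof.
move=> p q r; pose n := maxn (size q) (size r).
rewrite !(@ore_mul_widen n) ?leq_maxl ?leq_maxr ?size_polyD //.
by rewrite -big_split; apply: eq_bigr => j _; rewrite coefD polyCD mulrDr.
Qed.

Lemma ore_mulDl : left_distributive ore_mul +%R.
Proof.
move=> p q r; rewrite /ore_mul -big_split; apply: eq_bigr => j _ /=.
by rewrite -mulrDl; congr (_ * _); elim: (j : nat) => //= i ->; rewrite raddfD.
Qed.

Lemma ore_mulC p a : ore_mul p a%:P = p * a%:P.
Proof.
by rewrite (@ore_mul_widen 1) ?size_polyC_leq1 // big_ord1 coefC.
Qed.

Lemma ore_mulXr p q : ore_mul p ('X * q) = ore_mul (ore_rmulX p) q.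
Proof.
have sq : (size ('X * q)%R <= (size q).+1)%N.
  by apply: leq_trans (size_polyMleq _ _) _; rewrite size_polyX.
rewrite (ore_mul_widen _ sq) big_ord_recl /= coefXM mulr0 add0r.
by apply: eq_bigr => j _; rewrite coefXM /= -iterS -iterSr.
Qed.

Lemma ore_mulX p : ore_mul p 'X = ore_rmulX p.
Proof. by rewrite -['X]mulr1 ore_mulXr -polyC1 ore_mulC mulr1. Qed.

Lemma ore_ind (P : {poly R} -> Prop) :
  (forall a, P a%:P) -> (forall p, P p -> P ('X * p)) ->
  (forall p q, P p -> P q -> P (p + q)) -> forall p, P p.
Proof.
move=> PC PX PD; elim/poly_ind => [|p c IHp]; first exact: (PC 0).
by rewrite commr_polyX; apply: PD => //; apply: PX.
Qed.

(** Associativity with D as right factor, from which the general case follows by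
    induction on the right factor. *)
Lemma ore_mul_rmulX p q : ore_mul p (ore_rmulX q) = ore_rmulX (ore_mul p q).
Proof.
elim/ore_ind: q p => [a|q IHq|q r IHq IHr] p.
- rewrite ore_rmulX_C -polyCN ore_mulDr ore_mulXr !ore_mulC ore_rmulX_mulC.
  by rewrite polyCN mulrN.
- by rewrite ore_rmulX_mulX !ore_mulXr IHq.
- have rD a b : ore_rmulX (a + b) = ore_rmulX a + ore_rmulX b by apply: raddfD.
  by rewrite (ore_mulDr p q r) !rD (ore_mulDr p (ore_rmulX q)) IHq IHr.
Qed.

Lemma ore_mulA : associative ore_mul.
Proof.
move=> p q r; elim/ore_ind: r q => [a|r IHr|r r' IHr IHr'] q; last first.
- by rewrite !ore_mulDr IHr IHr'.
- by rewrite !ore_mulXr IHr ore_mul_rmulX.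
rewrite !ore_mulC; elim/ore_ind: q p => [b|q IHq|q q' IHq IHq'] p.
- by rewrite -polyCM !ore_mulC polyCM mulrA.
- by rewrite -mulrA !ore_mulXr IHq.
- by rewrite mulrDl !ore_mulDr mulrDl IHq IHq'.
Qed.

Lemma ore_mul1 : left_id 1 ore_mul.
Proof.
suff H n q : ore_mul 'X^n q = 'X^n * q.
  by move=> q; have := H 0%N q; rewrite expr0 mul1r.
elim/ore_ind: q n => [a|q IHq|q r IHq IHr] n.
- by rewrite ore_mulC.
- rewrite ore_mulXr mulrA -exprSr -IHq; congr ore_mul.
  rewrite /ore_rmulX map_polyXn exprS (_ : map_poly der 'X^n = 0) ?subr0 //.
  apply/polyP=> i; rewrite coef_map coefXn coef0 /=.
  by case: eqP => _; rewrite ?raddf0 ?ore_der1.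
- by rewrite ore_mulDr IHq IHr mulrDr.
Qed.

Lemma ore_mulr1 : right_id 1 ore_mul.
Proof. by move=> p; rewrite -polyC1 ore_mulC mulr1. Qed.

(** The data are phantom in the carrier, so that each twist has its own ring
    structure. *)
Definition ore (_ : ore_data) := {poly R}.
HB.instance Definition _ := GRing.Zmodule.on (ore s).

Fact ore_1neq0 : (1 : {poly R}) != 0.
Proof. exact: oner_neq0. Qed.
HB.instance Definition _ := GRing.Zmodule_isNzRing.Build (ore s)
  ore_mulA ore_mul1 ore_mulr1 ore_mulDl ore_mulDr ore_1neq0.

Definition ore_scale (c : k) (p : ore s) : ore s := (c%:A : R) *: (p : {poly R}).

Fact ore_scaleA a b p : ore_scale a (ore_scale b p) = ore_scale (a * b) p.
Proof. by rewrite /ore_scale scalerA mulr_algl scalerA. Qed.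
Fact ore_scale1 : left_id 1 ore_scale.
Proof. by move=> p; rewrite /ore_scale scale1r scale1r. Qed.
Fact ore_scaleDr : right_distributive ore_scale +%R.
Proof. by move=> a p q; apply: scalerDr. Qed.
Fact ore_scaleDl p : {morph ore_scale^~ p : a b / a + b}.
Proof. by move=> a b; rewrite /ore_scale !scalerDl. Qed.
HB.instance Definition _ := GRing.Zmodule_isLmodule.Build k (ore s)
  ore_scaleA ore_scale1 ore_scaleDr ore_scaleDl.

Fact ore_scaleAl a (p q : ore s) : a *: (p * q) = a *: p * q.
Proof.
rewrite /GRing.scale /GRing.mul /= /ore_scale /ore_mul scaler_sumr.
apply: eq_bigr => j _; rewrite [LHS]scalerAl.
suff -> : iter j ore_rmulX ((a%:A : R) *: (p : {poly R})) =
  (a%:A : R) *: iter j ore_rmulX p by [].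
by elim: (j : nat) => //= i ->; rewrite ore_rmulXZ.
Qed.
HB.instance Definition _ := GRing.Lmodule_isLalgebra.Build k (ore s) ore_scaleAl.

Fact ore_scaleAr a (p q : ore s) : a *: (p * q) = p * (a *: q).
Proof.
rewrite /GRing.scale /GRing.mul /= /ore_scale.
elim/ore_ind: q p => [b|q IHq|q r IHq IHr] p.
- rewrite -[_ *: b%:P]mul_polyC -polyCM !ore_mulC; apply/polyP=> i.
  by rewrite coefZ !coefMC !mulr_algl scalerAr.
- have -> : (a%:A : R) *: ('X * q) = 'X * (a%:A *: q).
    by rewrite -!mul_polyC !mulrA commr_polyX.
  by rewrite !ore_mulXr IHq.
- by rewrite ore_mulDr !scalerDr ore_mulDr IHq IHr.
Qed.
HB.instance Definition _ := GRing.Lalgebra_isAlgebra.Build k (ore s) ore_scaleAr.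

Definition ore_var : ore s := 'X.
Definition ore_const (a : R) : ore s := a%:P.

Fact ore_const_zmod : zmod_morphism ore_const.
Proof. by move=> a b; rewrite /ore_const polyCB. Qed.
HB.instance Definition _ :=
  GRing.isZmodMorphism.Build R (ore s) ore_const ore_const_zmod.

Fact ore_const_monoid : monoid_morphism ore_const.
Proof. by split=> // a b; rewrite [RHS]ore_mulC -polyCM. Qed.
HB.instance Definition _ :=
  GRing.isMonoidMorphism.Build R (ore s) ore_const ore_const_monoid.

Fact ore_constZ : scalable ore_const.
Proof.
move=> a b; rewrite /GRing.scale /= /ore_scale /ore_const.
by rewrite -mul_polyC -polyCM mulr_algl.
Qed.
HB.instance Definition _ :=
  GRing.isScalable.Build k R (ore s) *:%R ore_const ore_constZ.

Lemma ore_const_var a :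
  ore_const a * ore_var = ore_var * ore_const (tau a) - ore_const (der a).
Proof. by rewrite [LHS]ore_mulX ore_rmulX_C [in RHS]/GRing.mul /= ore_mulC. Qed.

Lemma ore_var_const a : ore_var * ore_const a = ('X * a%:P)%R :> {poly R}.
Proof. exact: ore_mulC. Qed.

End OreExtension.

(** * Degrees in Ore extensions of k[X] *)

Section OreDegree.
Variables (k : fieldType) (s : ore_data {poly k}).
Local Notation tau := (ore_tau s).
Local Notation der := (ore_der s).
Hypothesis tau_inj : injective tau.

Lemma ore_rmulX_lead (p : {poly {poly k}}) : p != 0 ->
  size (ore_rmulX s p) = (size p).+1 /\
  lead_coef (ore_rmulX s p) = tau (lead_coef p).
Proof.
move=> p0; have tau_p0 : map_poly tau p != 0.
  by rewrite map_poly_eq0_id0 // raddf_eq0 // lead_coef_eq0.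
have sX : size ('X * map_poly tau p)%R = (size p).+1.
  by rewrite -commr_polyX size_mulX // size_map_inj_poly ?raddf0.
have sD : (size (- map_poly der p)%R < size ('X * map_poly tau p)%R)%N.
  by rewrite sX ltnS size_polyN size_poly.
rewrite /ore_rmulX size_polyDl // lead_coefDl // sX; split=> //.
by rewrite -commr_polyX lead_coefMX lead_coef_map_inj ?raddf0.
Qed.

(** The leading term of (D^i a) (D^j b) is D^(i + j) tau^j(a) b, which is
    nonzero because tau is injective and k[X] is a domain. *)
Lemma ore_mul_lead (p q : {poly {poly k}}) : p != 0 -> q != 0 ->
  size (ore_mul s p q) = (size p + size q).-1 /\
  lead_coef (ore_mul s p q) = iter (size q).-1 tau (lead_coef p) * lead_coef q.
Proof.
elim/poly_ind: q p => [|q c IHq] p p0 qc0; first by rewrite eqxx in qc0.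
rewrite commr_polyX ore_mulDr ore_mulXr ore_mulC.
have [q0|q0] := eqVneq q 0.
  have c0 : c != 0.
    by move: qc0; rewrite q0 mul0r add0r polyC_eq0.
  rewrite q0 mulr0 /ore_mul size_poly0 !big_ord0 !add0r size_mul ?polyC_eq0 //.
  by rewrite lead_coefM lead_coefC size_polyC c0.
have [rp0 lrp] := ore_rmulX_lead p0.
have rp_neq0 : ore_rmulX s p != 0 by rewrite -size_poly_gt0 rp0.
have [sq lq] := IHq _ rp_neq0 q0.
have q_gt0 : (0 < size q)%N by rewrite size_poly_gt0.
have lt_sz : (size (p * c%:P)%R < size (ore_mul s (ore_rmulX s p) q))%N.
  rewrite sq rp0 (leq_ltn_trans (size_polyMleq _ _)) //.
  case: (size q) q_gt0 => // n _; rewrite addSn addnS /= ltnS.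
  by case: (c =P 0) => [->|/eqP c0]; rewrite size_polyC ?eqxx ?c0 /=
    ?addn0 ?addn1 /= ?(leq_trans (leq_pred _)) ?leq_addr.
have szX : size ('X * q + c%:P) = (size q).+1.
  by rewrite -commr_polyX size_MXaddC (negPf q0).
rewrite size_polyDl // lead_coefDl // sq lq rp0 szX lrp; split.
  by rewrite addSn addnS.
rewrite -commr_polyX lead_coefDl ?lead_coefMX; last first.
  by rewrite size_mulX // size_polyC (leq_ltn_trans (leq_b1 _)).
congr (_ * _); case: (size q) q_gt0 => // n _ /=.
by rewrite -iterS -iterSr.
Qed.

(** Modulo (D + 1) the row entry r satisfies r D = - t with
    t = tau(r) + der(r), so comaximality of r and t makes the row unimodular.
    An element D a + b of the kernel ideal must satisfy t a = r b, hence r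
    divides a.  A generator therefore has degree 1 and leading coefficient
    in r k[X], and all its multiples of degree 2 have leading coefficient in
    tau(r) k[X], whereas the ideal contains a monic element of degree 2. *)
Lemma ore_kernel_not_cyclic (r x y : {poly k}) :
    r * x + (tau r + der r) * y = 1 -> size (tau r) != 1%N ->
  forall c c' : ore s,
    ore_const s r * c = (ore_var s + 1) * c' ->
  ~ (forall v v' : ore s, ore_const s r * v = (ore_var s + 1) * v' ->
     exists g, v = c * g).
Proof.
set t := tau r + der r => rt1 nunit c c' rc gen.
pose C := ore_const s; pose D : ore s := ore_var s; rewrite -/C -/D in rc gen *.
have CM a b : C (a * b) = C a * C b by apply: rmorphM.
have CD a b : C (a + b) = C a + C b by apply: rmorphD.
have CN a : C (- a) = - C a by apply: rmorphN.
have CB a b : C (a - b) = C a - C b by apply: rmorphB.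
have sw a : C a * D = (D + 1) * C (tau a) - C (tau a + der a).
  rewrite [LHS]ore_const_var mulrDl mul1r CD opprD -/C -/D.
  by rewrite addrA addrK.
have r0 : r != 0.
  apply/eqP => r0; move: rt1; rewrite /t r0 !raddf0 addr0 !mul0r addr0.
  by move/eqP; rewrite eq_sym oner_eq0.
have polyE (a b : {poly k}) :
    D * C a + C b = ('X * a%:P + b%:P)%R :> {poly {poly k}}.
  by rewrite /D /C ore_var_const.
(* Modulo (D + 1), r D^2 = - t D = t'.  The tail D b + d is the solution of
   t' - t b + r d = 0 given by the relation r x + t y = 1. *)
pose t' := tau t + der t; pose b := y * t'; pose d := - (x * t').
have [g1 E1] : exists g, D * C r + C t = c * g.
  apply: (gen _ (C (tau r * r))); rewrite mulrDr mulrA sw mulrBl -addrA -!CM.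
  by rewrite -mulrA -!CM [t * r]mulrC addNr addr0.
have [g2 E2] : exists g, D * D + D * C b + C d = c * g.
  apply: (gen _ (C (tau r) * D - C (tau t) + C (tau r * b))).
  have rD : C r * D = (D + 1) * C (tau r) - C t := sw r.
  have tD : C t * D = (D + 1) * C (tau t) - C t' := sw t.
  have rd : C (r * d) = C (t * b) - C t'.
    rewrite -CB; congr C; rewrite /d /b.
    have -> : t * (y * t') - t' = (t * y - 1) * t' by ring.
    by rewrite -rt1; ring.
  have tb : C t * C b = C (t * b) by rewrite CM.
  rewrite !(mulrDr (C r)) ![C r * (D * _)]mulrA rD !mulrBl tD tb -(CM r) rd.
  have Cb : C (tau r * b) = C (tau r) * C b by rewrite CM.
  rewrite !(mulrDr (D + 1)) mulrN Cb !mulrA opprB -!addrA.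
  by congr (_ + _); rewrite addKr (addrA (- _)) addrC subrK.

have neq0C (p q : ore s) : p != 0 -> p = c * q -> c != 0 /\ q != 0.
  by move=> p0 pE; split; apply: contraNneq p0 => z0; rewrite pE z0 ?mul0r ?mulr0.
pose sz (p : ore s) := size (p : {poly {poly k}}).
pose ld (p : ore s) := lead_coef (p : {poly {poly k}}).
have szM p q : p != 0 -> q != 0 -> sz (p * q) = (sz p + sz q).-1.
  by move=> p0 q0; have [] := ore_mul_lead p0 q0.
have ldM p q : p != 0 -> q != 0 ->
    ld (p * q) = iter (sz q).-1 tau (ld p) * ld q.
  by move=> p0 q0; have [] := ore_mul_lead p0 q0.
have sz_gt0 p : p != 0 -> (0 < sz p)%N by rewrite -size_poly_gt0.
have szD1 : sz (D + 1) = 2%N by rewrite /sz size_XaddC.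
have D1_0 : D + 1 != 0 by rewrite -size_poly_eq0 -/(sz _) szD1.
have Cr0 : C r != 0 by rewrite polyC_eq0.
have szCr : sz (C r) = 1%N by rewrite /sz size_polyC r0.
pose v1 := D * C r + C t; pose v2 := D * D + D * C b + C d.
(* Rewriting in the commutative polynomial ring gives sizes and leading
   coefficients. *)
have v1E : v1 = r%:P * 'X + t%:P :> {poly {poly k}} by rewrite /v1 polyE commr_polyX.
have szv1 : sz v1 = 2%N.
  by rewrite /sz v1E size_MXaddC polyC_eq0 (negPf r0) size_polyC r0.
have v1_0 : v1 != 0 by rewrite -size_poly_eq0 -/(sz _) szv1.
have v2E : v2 = ('X + b%:P) * 'X + d%:P :> {poly {poly k}}.
  rewrite /v2 -addrA mulrDl [b%:P * _]commr_polyX -addrA -polyE; congr (_ + _).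
  by rewrite [LHS]ore_mulX ore_rmulX_X.
have szv2 : sz v2 = 3%N.
  by rewrite /sz v2E size_MXaddC -size_poly_eq0 size_XaddC.
have v2_0 : v2 != 0 by rewrite -size_poly_eq0 -/(sz _) szv2.
have ldv2 : ld v2 = 1.
  rewrite /ld v2E lead_coefDl ?lead_coefMX ?lead_coefXaddC //.
  by rewrite size_mulX -?size_poly_eq0 ?size_XaddC // size_polyC; case: (d != 0).
have [c0 g1_0] := neq0C _ _ v1_0 E1; have [_ g2_0] := neq0C _ _ v2_0 E2.
have c'0 : c' != 0.
  have rc0 : C r * c != 0.
    rewrite -size_poly_eq0 -/(sz _) szM // szCr add1n /= -lt0n; exact: sz_gt0.
  by apply: contraNneq rc0 => c'0; rewrite rc c'0 mulr0.
have szc : sz c = (sz c').+1.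
  by have := congr1 sz rc; rewrite !szM // szCr szD1.
have szc'1 : sz c' = 1%N.
  have := congr1 sz E1; rewrite -/v1 szM // szv1 szc.
  by have := sz_gt0 _ c'0; have := sz_gt0 _ g1_0; lia.
(* Comparing both coefficients of r c = (D + 1) c' with c = D a + a0 and
   c' = e gives e = tau(r) a and t a = r a0. *)
have rD : C r * D = (D + 1) * C (tau r) - C t := sw r.
pose e := (c' : {poly {poly k}})`_0; have c'E : c' = C e.
  by rewrite [LHS]size1_polyC // -/(sz c') szc'1.
pose a := (c : {poly {poly k}})`_1; pose a0 := (c : {poly {poly k}})`_0.
have cE : c = D * C a + C a0.
  rewrite polyE; apply/polyP=> i; rewrite coefD coefXM coefC coefC.
  case: i => [|[|i]] /=; rewrite ?add0r ?addr0 // nth_default //.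
  by rewrite -/(sz c) szc szc'1.
have lin : D * C (tau r * a) + C (tau r * a - t * a + r * a0) = D * C e + C e.
  have -> : D * C e + C e = C r * c by rewrite rc c'E mulrDl mul1r.
  rewrite CD CB !CM cE.
  rewrite (mulrDr (C r)) [C r * (D * _)]mulrA rD mulrBl.
  rewrite -[_ * C (tau r) * _]mulrA mulrDl mul1r.
  by rewrite !addrA.
rewrite !polyE in lin.
have /eqP e1 : tau r * a == e.
  have := congr1 (fun p : {poly {poly k}} => p`_1) lin.
  by rewrite !coefD !coefXM !coefC /= !addr0 => ->.
have e0 : tau r * a - t * a + r * a0 = e.
  have := congr1 (fun p : {poly {poly k}} => p`_0) lin.
  by rewrite !coefD !coefXM !coefC /= !add0r => ->.
have ra : a = r * (a * x + a0 * y).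
  have ta : t * a = r * a0.
    apply/eqP; rewrite eq_sym -subr_eq0; apply/eqP; apply: (addrI (tau r * a)).
    by rewrite addr0 [RHS]e1 -e0; ring.
  rewrite -[LHS]mulr1 -rt1 mulrDr mulrA [a * (t * y)]mulrA [a * t]mulrC ta; ring.
have szg2 : sz g2 = 2%N.
  by have := congr1 sz E2; rewrite -/v2 szM // szv2 szc szc'1; lia.
(* The leading coefficient of the monic element is a multiple of tau(r). *)
have := congr1 ld E2; rewrite -/v2 ldM // ldv2 szg2 /=.
have -> : ld c = a by rewrite /ld lead_coefE -/(sz c) szc szc'1.
rewrite ra rmorphM -mulrA => /esym tr_unit; move: nunit.
have tr0 : tau r != 0 by rewrite raddf_eq0.
set z := _ * ld g2 in tr_unit.
have z0 : z != 0.
  by apply: contra_eq_neq tr_unit => ->; rewrite mulr0 eq_sym oner_eq0.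
have := congr1 (fun p : {poly k} => size p) tr_unit; rewrite size_poly1.
rewrite size_mul //; move: z0 tr0; rewrite -!size_poly_gt0.
case: (size z) => [//|n] _; case: (size (tau r)) => [//|[//|m]] _.
by rewrite addSn addnS.
Qed.
End OreDegree.

(** * Unimodular rows with entry D + 1 *)

Section Unimodular.
Variables (k : fieldType) (A : algType k) (D p : A).

Let J (v : A) : Prop := exists x y, p * x + (D + 1) * y = v.

Let JD u v : J u -> J v -> J (u + v).
Proof.
move=> [x [y <-]] [x' [y' <-]]; exists (x + x'), (y + y').
by rewrite !mulrDr addrACA.
Qed.

Let JM u a : J u -> J (u * a).
Proof.
by move=> [x [y <-]]; exists (x * a), (y * a); rewrite [RHS]mulrDl -!mulrA.
Qed.

Let JZ c u : J u -> J (c *: u).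
Proof. by move=> /(JM c%:A); rewrite mulr_algr. Qed.

Let JB u v : J u -> J v -> J (u - v).
Proof. by move=> Ju /(JZ (-1)) Jv; rewrite -scaleN1r; apply: JD. Qed.

Let Jp : J p.
Proof. by exists 1, 0; rewrite mulr1 mulr0 addr0. Qed.

(* When v D = D w - z, right multiplication by D acts modulo D + 1 on a + v by
   - (a + w + z). *)
Let J_step a v w z : v * D = D * w - z -> J (a%:A + v) -> J (a%:A + (w + z)).
Proof.
move=> vD /(JM D) Jv.
have -> : a%:A + (w + z) = (D + 1) * (a%:A + w) - (a%:A + v) * D.
  rewrite !mulrDl vD mulrDr mul1r mulr_algl mulr_algr opprD opprB.
  rewrite [_ + (a%:A + w)]addrC -!addrA; congr (_ + (_ + _)).
  by rewrite (addrCA (D * w)) addNKr addrCA subrr addr0.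
by apply: JB => //; exists 0, (a%:A + w); rewrite mulr0 add0r.
Qed.

Let J_one c v : c != 1 -> J (1 + v) -> J (1 + c *: v) -> J 1.
Proof.
move=> c1 Jv /JB/(_ (JZ c Jv)).
rewrite scalerDr opprD addrACA subrr addr0 -{1}[1]scale1r -scalerBl.
by move=> /(JZ (1 - c)^-1); rewrite scalerA mulVf ?scale1r // subr_eq0 eq_sym.
Qed.

(** If right multiplication by D acts modulo (D + 1) on v as - c, the right
    ideal contains 1 + v and 1 + c v. *)
Lemma unimodular_eigenvector c v w z : c != 1 -> p = 1 + v ->
    v * D = D * w - z -> w + z = c *: v ->
  exists x y, p * x + (D + 1) * y = 1.
Proof.
move=> c1 pE vD wz; apply: (J_one (c := c) (v := v)) => //; rewrite -?pE //.
rewrite -wz -[1]scale1r; apply: J_step vD _; rewrite scale1r -pE.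
exact: Jp.
Qed.

(** When z is an eigenvector and v an eigenvector only up to z, combining 1 + v
    with its image under D eliminates v and leaves a nonzero scalar plus a
    multiple of z, which the eigenvector argument handles. *)
Lemma unimodular_generalized_eigenvector c v z : c != 1 -> p = 1 + v ->
    v * D = D * (c *: v) - c *: z -> z * D = c *: (D * z) ->
  exists x y, p * x + (D + 1) * y = 1.
Proof.
move=> c1 pE vD zD; rewrite -/(J 1).
have Jv : J (1 + v) by rewrite -pE.
have Jv' : J (1 + (c *: v + c *: z)).
  by rewrite -[1]scale1r; apply: J_step vD _; rewrite scale1r.
have {Jv'} Jz : J ((1 - c)%:A + c *: z).
  have -> : (1 - c)%:A + c *: z = 1 + (c *: v + c *: z) - c *: (1 + v).
    rewrite scalerBl scale1r scalerDr opprD [c *: v + _]addrC [1 + (_ + _)]addrA.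
    by rewrite [RHS]addrACA subrr addr0 addrAC.
  by apply: JB => //; apply: JZ.
pose u := (c / (1 - c)) *: z.
have c1' : 1 - c != 0 by rewrite subr_eq0 eq_sym.
have Ju : J (1 + u).
  have := JZ (1 - c)^-1 Jz.
  by rewrite scalerDr !scalerA mulVf // scale1r mulrC.
have uD : u * D = D * (c *: u) - 0.
  by rewrite subr0 /u -scalerAl zD -!scalerAr !scalerA mulrC.
apply: (J_one (c := c) (v := u)) => //.
by have := J_step (a := 1) uD; rewrite scale1r addr0; apply.
Qed.

(** The right ideal contains z, hence v^2, and 1 - v^2 = p (1 - v). *)
Lemma unimodular_nilpotent v z :
    p = 1 + v -> v * D = D * v - z -> (exists a, v * v = z * a) ->
  exists x y, p * x + (D + 1) * y = 1.
Proof.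
move=> pE vD [a vv]; rewrite -/(J 1).
have Jv : J (1 + v) by rewrite -pE.
have Jv' : J (1 + (v + z)).
  by rewrite -[1]scale1r; apply: J_step vD _; rewrite scale1r.
have Jz : J z.
  suff -> : z = 1 + (v + z) - (1 + v) by apply: JB.
  by rewrite addrA [_ + z]addrC addrK.
have -> : 1 = (1 + v) * (1 - v) + z * a :> A.
  by rewrite -vv mulrDl mul1r mulrBr mulr1 addrA !subrK.
by apply: JD; apply: JM.
Qed.

End Unimodular.

(** * The normal element D U - r1 U D *)

Section Omega.
Variables (k : fieldType) (A : algType k) (r1 r2 : k) (U D : A).

Definition omega : A := D * U - r1 *: (U * D).

(** Factoring t^2 - alpha t - beta as (t - r1) (t - r2) turns each cubic relation
    into the statement that Om commutes with a generator up to r2. *)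
Lemma down_up_rel_omega :
  down_up_rel (r1 + r2) (- (r1 * r2)) 0 U D <->
  omega * U = r2 *: (U * omega) /\ D * omega = r2 *: (omega * D).
Proof.
have eqU : omega * U - r2 *: (U * omega) = D * U ^+ 2 -
    ((r1 + r2) *: (U * D * U) + - (r1 * r2) *: (U ^+ 2 * D) + 0 *: U).
  rewrite /omega scale0r addr0 mulrBl mulrBr -!scalerAr -!scalerAl scalerBr.
  rewrite scalerA scalerDl scaleNr !expr2 !mulrA [r2 * r1]mulrC.
  by rewrite -[LHS]addrA -opprD addrA.
have eqD : D * omega - r2 *: (omega * D) = D ^+ 2 * U -
    ((r1 + r2) *: (D * U * D) + - (r1 * r2) *: (U * D ^+ 2) + 0 *: D).
  rewrite /omega scale0r addr0 mulrBl mulrBr -!scalerAr -!scalerAl scalerBr.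
  rewrite scalerA scalerDl scaleNr !expr2 !mulrA [r2 * r1]mulrC.
  by rewrite -[LHS]addrA -opprD addrA.
rewrite /down_up_rel; split=> -[/eqP e1 /eqP e2]; split; apply/eqP.
- by rewrite -subr_eq0 eqU subr_eq0.
- by rewrite -subr_eq0 eqD subr_eq0.
- by rewrite -subr_eq0 -eqU subr_eq0.
- by rewrite -subr_eq0 -eqD subr_eq0.
Qed.

End Omega.

Lemma omega_map (k : fieldType) (A B : algType k) (phi : {lrmorphism A -> B})
  (r : k) (U D : A) : phi (omega r U D) = omega r (phi U) (phi D).
Proof.
have phiM : {morph phi : x y / x * y} by exact: rmorphM.
have phiB : {morph phi : x y / x - y} by exact: rmorphB.
by rewrite /omega phiB phiM; congr (_ - _); rewrite -phiM; exact: linearZ.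
Qed.

Section Row.
Variables (k : fieldType) (A : algType k) (r1 r2 : k) (U D : A).
Hypothesis rel : down_up_rel (r1 + r2) (- (r1 * r2)) 0 U D.
Local Notation Om := (omega r1 U D).

Lemma omega_duU : Om * U = r2 *: (U * Om).
Proof. by have /down_up_rel_omega[] := rel. Qed.

Lemma omega_duD : r2 != 0 -> Om * D = r2^-1 *: (D * Om).
Proof.
move=> r2_neq0; have /down_up_rel_omega[_ ->] := rel.
by rewrite scalerA mulVf // scale1r.
Qed.

Lemma duU_duD : r1 != 0 -> U * D = D * (r1^-1 *: U) - r1^-1 *: Om.
Proof.
move=> r1_neq0; rewrite -scalerAr -scalerBr /omega subKr.
by rewrite scalerA mulVf // scale1r.
Qed.

(** The value of e solves e / r2 + 1 / r1 = e / r1, which makes U + e Om an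
    eigenvector. *)
Lemma unimodular_row_distinct (e := r2 / (r2 - r1)) :
    r1 != 0 -> r2 != 0 -> r1 != 1 -> r1 != r2 ->
  exists x y, (1 + (U + e *: Om)) * x + (D + 1) * y = 1.
Proof.
move=> r1_neq0 r2_neq0 r1_neq1 r12.
have r21 : r2 - r1 != 0 by rewrite subr_eq0 eq_sym.
apply: (@unimodular_eigenvector _ _ _ _ r1^-1 (U + e *: Om)
  (r1^-1 *: U + (e / r2) *: Om) (r1^-1 *: Om)) => //.
- by rewrite invr_eq1.
- rewrite mulrDl duU_duD // -scalerAl omega_duD // scalerA.
  by rewrite (mulrDr D (r1^-1 *: U)) (scalerAr (e / r2)) addrAC.
- rewrite (scalerDr r1^-1 U) -addrA -scalerDl scalerA; congr (_ + _ *: _).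
  by rewrite /e; field; rewrite r1_neq0 r2_neq0 r21.
Qed.

(** With equal roots, U is only a generalized eigenvector.  The null term keeps the
    shape shared with the case of distinct roots. *)
Lemma unimodular_row_double : r1 != 0 -> r1 != 1 -> r1 = r2 ->
  exists x y, (1 + (U + 0 *: Om)) * x + (D + 1) * y = 1.
Proof.
move=> r1_neq0 r1_neq1 r12; rewrite scale0r addr0.
apply: (@unimodular_generalized_eigenvector _ _ _ _ r1^-1 U Om) => //.
- by rewrite invr_eq1.
- exact: duU_duD.
- by rewrite omega_duD -?r12.
Qed.

(** Here Om is central: (Om U) D = D (Om U) - Om^2. *)
Lemma unimodular_row_unipotent : r1 = 1 -> r2 = 1 ->
  exists x y, (1 + Om * U) * x + (D + 1) * y = 1.
Proof.
move=> r1_1 r2_1.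
have omU : Om * U = U * Om by rewrite [LHS]omega_duU r2_1 scale1r.
have omD : Om * D = D * Om by rewrite omega_duD r2_1 ?oner_neq0 // invr1 scale1r.
have UD : U * D = D * U - Om.
  by rewrite [LHS]duU_duD r1_1 ?oner_neq0 // invr1 !scale1r.
apply: (@unimodular_nilpotent _ _ _ _ (Om * U) (Om * Om)) => //.
  by rewrite -mulrA UD mulrBr !mulrA omD.
by exists (U * U); rewrite -!mulrA [U * (Om * _)]mulrA -omU -!mulrA.
Qed.

End Row.

(** * Regularity of D + 1 *)

Section CentralVariable.
Variables (k : fieldType) (A : algType k).

Fact central_leibniz (a b : A) :
  (\0 : A -> A) (a * b) = \0 a * idfun b + a * \0 b.
Proof. by rewrite mul0r mulr0 addr0. Qed.

(** The untwisted extension A[X], with X central.  It is needed as an algebra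
    over k, although A is noncommutative. *)
Definition central_data : ore_data A := OreData central_leibniz.
Local Notation T := (ore central_data).
Local Notation X := (ore_var central_data).
Local Notation C := (ore_const central_data).

Lemma central_mulE (P Q : T) :
  P * Q = ((P : {poly A}) * (Q : {poly A}))%R :> {poly A}.
Proof.
have rX (p : {poly A}) : ore_rmulX central_data p = 'X * p.
  rewrite /ore_rmulX (map_poly_id (g := idfun)) //.
  rewrite (_ : map_poly _ p = 0) ?subr0 //.
  by apply/polyP=> i; rewrite coef_map coef0.
suff mulE (p q : {poly A}) : ore_mul central_data p q = p * q by exact: mulE.
elim/ore_ind: q p => [a|q IHq|q q' IHq IHq'] p.
- exact: ore_mulC.
- by rewrite ore_mulXr IHq rX -commr_polyX mulrA.
- by rewrite ore_mulDr IHq IHq' mulrDr.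
Qed.

Lemma central_var (a : A) : C a * X = X * C a.
Proof. by rewrite ore_const_var subr0. Qed.

(** Evaluation at X = 1. *)
Lemma central_eval : exists ev : {lrmorphism T -> A}, forall a, ev (X * C a) = a.
Proof.
pose ev (P : T) : A := (P : {poly A}).[1].
have evB : zmod_morphism ev by move=> P Q; rewrite /ev hornerD hornerN.
have evM : monoid_morphism ev.
  split; first exact: hornerC.
  by move=> P Q; rewrite /ev central_mulE hornerM_comm // /comm_poly mulr1 mul1r.
have evZ : scalable ev by move=> a P; rewrite /ev hornerZ mulr_algl.
pose Ev : {lrmorphism T -> A} := HB.pack ev
  (GRing.isZmodMorphism.Build _ _ ev evB)
  (GRing.isMonoidMorphism.Build _ _ ev evM)
  (GRing.isScalable.Build _ _ _ _ ev evZ).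
exists Ev => a; rewrite [LHS]/(ev (X * C a)) /ev ore_var_const -commr_polyX.
by rewrite hornerMX hornerC mulr1.
Qed.

(** The constant term of the left factor is 1. *)
Lemma central_regular (a : A) (P : T) : (X * C a + 1) * P = 0 -> P = 0.
Proof.
move=> aP0; apply/polyP => i; rewrite coef0.
have aP j : (('X * a%:P + 1) * (P : {poly A}))%R`_j = 0.
  have := congr1 (fun Q : T => (Q : {poly A})`_j) aP0.
  by rewrite central_mulE ore_var_const coef0.
elim: i => [|i IHi].
  by have := aP 0%N; rewrite mulrDl mul1r coefD -mulrA coefXM add0r.
have := aP i.+1.
by rewrite mulrDl mul1r coefD -mulrA coefXM coefCM IHi mulr0 add0r.
Qed.

(** Both sides of each relation are homogeneous of degree 3, because the linear
    term of the relations has coefficient 0. *)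
Lemma central_down_up_rel (alpha beta : k) (U D : A) :
  down_up_rel alpha beta 0 U D ->
  down_up_rel alpha beta 0 (X * C U) (X * C D).
Proof.
have XM a b : X * C a * (X * C b) = X * X * C (a * b).
  by rewrite -mulrA [C a * (X * _)]mulrA central_var rmorphM !mulrA.
have XM3 a b c : X * C a * (X * C b) * (X * C c) = X * X * X * C (a * b * c).
  by rewrite XM -mulrA [C _ * (X * _)]mulrA central_var [C (_ * c)]rmorphM !mulrA.
rewrite /down_up_rel; move uE: (X * C U) => u; move dE: (X * C D) => d.
rewrite !expr2 !mulrA -uE -dE !XM3 !scale0r !addr0.
move=> [-> ->].
have CD a b : C (a + b) = C a + C b by apply: rmorphD.
have CZ c a : C (c *: a) = c *: C a by apply: linearZ.
by rewrite !(CD, CZ) !(mulrDr, scalerAr).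
Qed.

End CentralVariable.

(** The morphism U |-> X U, D |-> X D embeds the algebra in its polynomial ring,
    since evaluating X at 1 inverts it, and there D + 1 becomes X D + 1. *)
Lemma down_up_regular (k : fieldType) (alpha beta : k)
    (u : down_up alpha beta 0) :
  (duD alpha beta 0 + 1) * u = 0 -> u = 0.
Proof.
have [ev evX] := central_eval (down_up alpha beta 0).
have /down_up_univ[phi [phiU phiD]] :=
  central_down_up_rel (down_up_relP alpha beta 0).
have evK v : ev (phi v) = v.
  have := @down_up_univ_uniq _ _ _ _ _
    (ev \o phi : {lrmorphism down_up alpha beta 0 -> down_up alpha beta 0}) idfun.
  by apply; rewrite /= ?phiU ?phiD evX.
move=> /(congr1 phi); rewrite rmorphM rmorphD rmorph1 /= phiD => Du0.
rewrite -[u]evK (central_regular (etrans Du0 (rmorph0 phi))).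
exact: rmorph0.
Qed.

(** * Quantum planes and the Weyl algebra *)

Section Coefficients.
Variable k : fieldType.

Fact quantum_leibniz (tau : {poly k} -> {poly k}) (a b : {poly k}) :
  (\0 : {poly k} -> {poly k}) (a * b) = \0 a * tau b + a * \0 b.
Proof. by rewrite mul0r mulr0 addr0. Qed.

(** The quantum plane X D = c D X. *)
Definition quantum_data (c : k) : ore_data {poly k} :=
  OreData (quantum_leibniz (comp_poly (c *: 'X))).

(** The Weyl algebra X D = D X - 1. *)
Definition weyl_data : ore_data {poly k} :=
  @OreData k {poly k} idfun (@deriv k) (@derivM k).

Lemma quantum_tau_inj c : c != 0 -> injective (ore_tau (quantum_data c)).
Proof.
move=> c0; apply: (can_inj (g := comp_poly (c^-1 *: 'X))) => p /=.
rewrite -comp_polyA comp_polyZ comp_polyX scalerA mulfV // scale1r.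
exact: comp_polyXr.
Qed.

Lemma omega_quantum (q : k) (s := quantum_data q^-1) : q != 0 ->
  omega q (ore_const s 'X) (ore_var s) = 0.
Proof.
move=> q_neq0; apply/eqP; rewrite subr_eq0; apply/eqP.
rewrite ore_const_var /= rmorph0 subr0 comp_polyX.
by rewrite [ore_const s (_ *: _)]linearZ /= -scalerAr scalerA mulfV // scale1r.
Qed.

Lemma omega_weyl : omega 1 (ore_const weyl_data 'X) (ore_var weyl_data) = 1.
Proof. by rewrite /omega scale1r ore_const_var subKr /= derivX rmorph1. Qed.

End Coefficients.

Section Criterion.
Variables (k : fieldType) (alpha beta : k).
Local Notation A := (down_up alpha beta 0).
Local Notation D := (duD alpha beta 0).

(** It is enough to find a unimodular row (p, D + 1) in the down-up algebra and a
    morphism to an Ore extension of k[X] sending it to a row without cyclic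
    kernel ideal. *)
Lemma nontrivial_ideal (s : ore_data {poly k}) (phi : {lrmorphism A -> ore s})
    (p : A) (r a b : {poly k}) :
    injective (ore_tau s) ->
    (exists x y, p * x + (D + 1) * y = 1) ->
    phi D = ore_var s -> phi p = ore_const s r ->
    r * a + (ore_tau s r + ore_der s r) * b = 1 ->
    size (ore_tau s r) != 1%N ->
  exists I : right_ideal A, nontrivial_stably_free_right_ideal I.
Proof.
move=> tau_inj [x [y pq1]] phiD phip rab nunit.
have [|eps _] := @down_up_univ k alpha beta 0 k^o 0 0.
  by split; rewrite !(mul0r, mulr0, scaler0, addr0).
exists (kernel_ideal p (D + 1)).
have phiq : phi (D + 1) = ore_var s + 1 by rewrite rmorphD rmorph1 /= phiD.
apply: (kernel_ideal_nontrivial eps pq1 (@down_up_regular _ _ _)).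
move=> c c' pc gen.
have pc' : ore_const s r * phi c = (ore_var s + 1) * phi c'.
  by rewrite -phip -phiq -!rmorphM pc.
apply: (ore_kernel_not_cyclic tau_inj rab nunit pc') => v u.
rewrite -phip -phiq; exact: kernel_ideal_generator_map pq1 gen v u.
Qed.

End Criterion.

Section QuantumCase.
Variables (k : fieldType) (r1 r2 : k).
Hypotheses (r1_neq0 : r1 != 0) (r1_neq1 : r1 != 1).
Local Notation A := (down_up (r1 + r2) (- (r1 * r2)) 0).
Local Notation U := (duU (r1 + r2) (- (r1 * r2)) 0).
Local Notation D := (duD (r1 + r2) (- (r1 * r2)) 0).

Lemma nontrivial_ideal_quantum (e : k) :
    (exists x y, (1 + (U + e *: omega r1 U D)) * x + (D + 1) * y = 1) ->
  exists I : right_ideal A, nontrivial_stably_free_right_ideal I.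
Proof.
move=> unimod; pose s := quantum_data r1^-1.
have om0 := omega_quantum r1_neq0; rewrite -/s in om0.
have rel : down_up_rel (r1 + r2) (- (r1 * r2)) 0 (ore_const s 'X) (ore_var s).
  by apply/down_up_rel_omega; rewrite om0 !mul0r !mulr0 !scaler0.
have [phi [phiU phiD]] := down_up_univ rel.
have phiO : phi (omega r1 U D) = 0.
  by rewrite omega_map phiU phiD.
have r1N1 : r1 - 1 != 0 by rewrite subr_eq0.
(* Here t = 1 + X / r1, and r1 t - (1 + X) = r1 - 1 is a unit. *)
apply: (@nontrivial_ideal _ _ _ s phi _ (1 + 'X) (- (r1 - 1)^-1)%:P
  (r1 / (r1 - 1))%:P _ unimod) => //.
- exact/quantum_tau_inj/invr_neq0.
- have phiZ : phi (e *: omega r1 U D) = 0.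
    by rewrite -(scaler0 _ e) -phiO; exact: linearZ.
  by rewrite !rmorphD !rmorph1 /= phiZ phiU addr0.
- rewrite /= addr0 rmorphD rmorph1 /= comp_polyX -mul_polyC polyCN polyCM.
  set c := (r1 - 1)^-1%:P.
  have r1V : r1^-1%:P * r1%:P = 1 :> {poly k} by rewrite -polyCM mulVf.
  have r1BV : (r1%:P - 1) * c = 1 by rewrite -polyCB -polyCM mulfV.
  have -> : (1 + 'X) * - c + (1 + r1^-1%:P * 'X) * (r1%:P * c) =
    (r1%:P - 1) * c + (r1^-1%:P * r1%:P - 1) * c * 'X by ring.
  by rewrite r1V r1BV subrr !mul0r addr0.
- rewrite /= rmorphD rmorph1 /= comp_polyX addrC size_polyDl.
    by rewrite size_scale ?invr_neq0 // size_polyX.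
  by rewrite size_scale ?invr_neq0 // size_polyX size_poly1.
Qed.

End QuantumCase.

Lemma nontrivial_ideal_weyl (k : fieldType) (r1 r2 : k) : r1 = 1 -> r2 = 1 ->
  exists I : right_ideal (down_up (r1 + r2) (- (r1 * r2)) 0),
    nontrivial_stably_free_right_ideal I.
Proof.
move=> r1_1 r2_1; pose s := weyl_data k.
have unimod := unimodular_row_unipotent (down_up_relP _ _ 0) r1_1 r2_1.
have om1 := omega_weyl k; rewrite -/s in om1.
have rel : down_up_rel (r1 + r2) (- (r1 * r2)) 0 (ore_const s 'X) (ore_var s).
  by apply/down_up_rel_omega; rewrite r1_1 r2_1 om1 !scale1r !mulr1 !mul1r.
have [phi [phiU phiD]] := down_up_univ rel.
(* Here t = (1 + X) + 1. *)
apply: (@nontrivial_ideal _ _ _ s phi _ (1 + 'X) (-1) 1 _ unimod) => //.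
- rewrite rmorphD rmorph1 rmorphM /= omega_map phiU phiD r1_1 om1 mul1r.
  by rewrite rmorphD rmorph1.
- by rewrite /= derivD derivX derivE; ring.
- by rewrite /= addrC -[1]polyC1 size_XaddC.
Qed.

(** * The theorem *)

Theorem proposition3p8 (k : fieldType) (char_k : [pchar k] =i pred0)
    (alpha beta : k) (beta_neq0 : beta != 0)
    (roots_k : exists r1 r2 : k,
       'X^2 - alpha *: 'X - beta%:P = ('X - r1%:P) * ('X - r2%:P)) :
  exists I : right_ideal (down_up alpha beta 0),
    nontrivial_stably_free_right_ideal I.
Proof.
have [r1 [r2 poly_eq]] := roots_k.
have betaE : beta = - (r1 * r2).
  have := congr1 (fun p : {poly k} => - p.[0]) poly_eq.
  rewrite !hornerE /= => e.
  by transitivity (- (0 ^+ 2 - 0 - beta)); [ring | rewrite e; ring].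
have alphaE : alpha = r1 + r2.
  have := congr1 (fun p : {poly k} => p.[1]) poly_eq.
  rewrite !hornerE /= betaE => e.
  by transitivity (1 + r1 * r2 - (1 ^+ 2 - alpha - - (r1 * r2)));
    [ring | rewrite e; ring].
move: beta_neq0; rewrite {}alphaE {}betaE oppr_eq0 mulf_eq0 negb_or.
move=> /andP[r1_neq0 r2_neq0].
have [r12|r12] := eqVneq r1 r2.
  have [r1_1|r1_1] := eqVneq r1 1.
    by apply: nontrivial_ideal_weyl; rewrite -?r12.
  apply: (nontrivial_ideal_quantum r1_neq0 r1_1 (e := 0)).
  exact: unimodular_row_double (down_up_relP _ _ 0) r1_neq0 r1_1 r12.
have [r1_1|r1_1] := eqVneq r1 1; last first.
  apply: (nontrivial_ideal_quantum r1_neq0 r1_1).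
  exact: unimodular_row_distinct (down_up_relP _ _ 0) r1_neq0 r2_neq0 r1_1 r12.
have r2_1 : r2 != 1 by rewrite -r1_1 eq_sym.
(* The roots play symmetric roles, and one of them differs from 1. *)
rewrite addrC mulrC; apply: (nontrivial_ideal_quantum r2_neq0 r2_1).
by apply: unimodular_row_distinct (down_up_relP _ _ 0) _ _ _ _; rewrite // eq_sym.
Qed.
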